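(* Let the equation of state be a general one as described in the context, let $\mathcal M$ be any given mesh with cells $\{\mathcal I_k\}$, and let $\alpha\ge1$. Consider the first-order scheme $$\bar{\mathbf U}_k^{n+1}=\bar{\mathbf U}_k^n-\frac{\Delta t_n}{|\mathcal I_k|}\sum_{j\in\mathcal N_k}|\mathcal E_{kj}|\,\hat{\mathbf F}_{kj},\qquad \hat{\mathbf F}_{kj}=\frac12\Big(\big\langle\boldsymbol\xi_{kj},\mathbf F(\bar{\mathbf U}_k^n)+\mathbf F(\bar{\mathbf U}_j^n)\big\rangle-\alpha(\bar{\mathbf U}_j^n-\bar{\mathbf U}_k^n)\Big).$$ Under the CFL condition $$0<\frac{\alpha\Delta t_n}{2|\mathcal I_k|}\sum_{j\in\mathcal N_k}|\mathcal E_{kj}|<1,$$ there always exists a set of admissible states $\{\bar{\mathbf U}_k^n,\ \forall k\}\subset\mathcal G$ such that the solution $\bar{\mathbf U}_k^{n+1}$ of the scheme does not belong to $\mathcal G$. In other words, the admissibility $\bar{\mathbf U}_k^n\in\mathcal G$ for all $k$ does not in general guarantee that $\bar{\mathbf U}_k^{n+1}\in\mathcal G$ for all $k$.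
   Context: Units are such that the speed of light is $c=1$; $\mathbb R^+=(0,\infty)$; $d\in\{2,3\}$. Equation of state (EOS): the specific enthalpy is a function $h=h(p,\rho)$, differentiable on $\mathbb R^+\times\mathbb R^+$, satisfying for all $p,\rho>0$ (i) $h(p,\rho)\ge\sqrt{1+p^2/\rho^2}+p/\rho$; (ii) $h\big(\tfrac1\rho-\tfrac{\partial h}{\partial p}\big)<\tfrac{\partial h}{\partial\rho}<0$; (iii) $\lim_{p\to0^+}h(p,\rho)=1$ for each fixed $\rho>0$. Conservative variables: given $\rho>0$, $p>0$, $\mathbf v\in\mathbb R^3$ with $|\mathbf v|<1$, $\mathbf B\in\mathbb R^3$, put $W=(1-|\mathbf v|^2)^{-1/2}$, $h=h(p,\rho)$, $p_m=\frac12\big(W^{-2}|\mathbf B|^2+(\mathbf v\cdot\mathbf B)^2\big)$, $p_{tot}=p+p_m$, and $$D=\rho W,\quad \mathbf m=\rho hW^2\mathbf v+|\mathbf B|^2\mathbf v-(\mathbf v\cdot\mathbf B)\mathbf B,\quad E=\rho hW^2-p_{tot}+|\mathbf B|^2,\quad \mathbf U=(D,\mathbf m,\mathbf B,E)^\top\in\mathbb R^8.$$ The admissible state set $\mathcal G\subset\mathbb R^8$ is the set of all $\mathbf U$ obtained in this way (i.e. $\rho(\mathbf U)>0$, $p(\mathbf U)>0$, $|\mathbf v(\mathbf U)|<1$). Fluxes: for $\mathbf U\in\mathcal G$ and $\ell=1,\dots,d$, with $\mathbf e_\ell$ the $\ell$-th row of the $3\times3$ identity matrix, $$\mathbf F_\ell(\mathbf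 U)=\Big(Dv_\ell,\ v_\ell\mathbf m-B_\ell\big(W^{-2}\mathbf B+(\mathbf v\cdot\mathbf B)\mathbf v\big)+p_{tot}\mathbf e_\ell,\ v_\ell\mathbf B-B_\ell\mathbf v,\ m_\ell\Big)^\top,$$ and $\langle\boldsymbol\xi,\mathbf F(\mathbf U)\rangle=\sum_{\ell=1}^d\xi_\ell\mathbf F_\ell(\mathbf U)$ for $\boldsymbol\xi\in\mathbb R^d$ (so $\langle\boldsymbol\xi,\mathbf F(\mathbf U)+\mathbf F(\tilde{\mathbf U})\rangle=\langle\boldsymbol\xi,\mathbf F(\mathbf U)\rangle+\langle\boldsymbol\xi,\mathbf F(\tilde{\mathbf U})\rangle$). Mesh: the $d$-dimensional spatial domain is divided into cells $\mathcal I_k$ that are non-self-intersecting $d$-polytopes (possibly unstructured). $\mathcal N_k$ is the index set of neighboring cells of $\mathcal I_k$; for $j\in\mathcal N_k$, $\mathcal E_{kj}=\partial\mathcal I_k\cap\partial\mathcal I_j$ is the common (flat) edge/face, and $\boldsymbol\xi_{kj}\in\mathbb R^d$ is its unit normal pointing from $\mathcal I_k$ to $\mathcal I_j$; $\partial\mathcal I_k$ is the union of the $\mathcal E_{kj}$, $j\in\mathcal N_k$. $|\mathcal I_k|$ and $|\mathcal E_{kj}|$ are the $d$- and $(d-1)$-dimensional Hausdorff measures. $\Delta t_n>0$ is the time step, and $\bar{\mathbf U}_k^n$ approximates the cell average of $\mathbf U$ over $\mathcal I_k$ at time $t_n$. *)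

(* Defs.v *)
From HB Require Import structures.
From mathcomp Require Import all_boot all_order all_algebra.
From mathcomp Require Import all_classical all_reals all_analysis.

Set Implicit Arguments.
Unset Strict Implicit.
Unset Printing Implicit Defensive.

Import Order.TTheory GRing.Theory Num.Theory.
Import numFieldNormedType.Exports.

Local Open Scope classical_set_scope.
Local Open Scope ring_scope.

(* The norm provided by the library on ['rV[R]_n] is the sup norm, so the
   Euclidean structure is introduced explicitly. *)
Definition dot (R : realType) (n : nat) (x y : 'rV[R]_n) : R :=
  \sum_(i < n) x 0 i * y 0 i.

Definition enorm (R : realType) (n : nat) (x : 'rV[R]_n) : R :=
  Num.sqrt (dot x x).

Definition eos (R : realType) (h : R -> R -> R) : Prop :=
  [/\ (forall p rho : R, 0 < p -> 0 < rho ->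
         differentiable (fun x : R * R => h x.1 x.2) ((p, rho) : R * R)),
      (forall p rho : R, 0 < p -> 0 < rho ->
         Num.sqrt (1 + p ^+ 2 / rho ^+ 2) + p / rho <= h p rho),
      (forall p rho : R, 0 < p -> 0 < rho ->
         h p rho * (rho^-1 - derive1 (fun p' => h p' rho) p)
           < derive1 (h p) rho /\
         derive1 (h p) rho < 0) &
      (forall rho : R, 0 < rho -> h p rho @[p --> 0^'+] --> (1 : R))].

Record prim (R : realType) : Type := Prim {
  rho : R;
  pres : R;
  vel : 'rV[R]_3;
  mag : 'rV[R]_3 }.

HB.instance Definition _ (R : realType) := gen_eqMixin (prim R).
HB.instance Definition _ (R : realType) := gen_choiceMixin (prim R).

Definition admissible_prim (R : realType) (w : prim R) : Prop :=
  [/\ 0 < rho w, 0 < pres w & enorm (vel w) < 1].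

Definition lorentz (R : realType) (w : prim R) : R :=
  (Num.sqrt (1 - enorm (vel w) ^+ 2))^-1.

Definition p_m (R : realType) (w : prim R) : R :=
  2^-1 * (lorentz w ^- 2 * enorm (mag w) ^+ 2 + dot (vel w) (mag w) ^+ 2).

Definition p_tot (R : realType) (w : prim R) : R := pres w + p_m w.

Definition enthalpy (R : realType) (h : R -> R -> R) (w : prim R) : R :=
  h (pres w) (rho w).

Definition density (R : realType) (w : prim R) : R := rho w * lorentz w.

Definition momentum (R : realType) (h : R -> R -> R) (w : prim R) : 'rV[R]_3 :=
  (rho w * enthalpy h w * lorentz w ^+ 2) *: vel w + enorm (mag w) ^+ 2 *: vel w
    - dot (vel w) (mag w) *: mag w.

Definition energy (R : realType) (h : R -> R -> R) (w : prim R) : R :=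
  rho w * enthalpy h w * lorentz w ^+ 2 - p_tot w + enorm (mag w) ^+ 2.

Definition state (R : realType) : Type := 'rV[R]_(1 + 3 + 3 + 1).

Definition mk_state (R : realType) (D : R) (m b : 'rV[R]_3) (E : R) : state R :=
  row_mx (row_mx (row_mx D%:M m) b) E%:M.

Definition cons (R : realType) (h : R -> R -> R) (w : prim R) : state R :=
  mk_state (density w) (momentum h w) (mag w) (energy h w).

Definition G (R : realType) (h : R -> R -> R) : set (state R) :=
  [set cons h w | w in [set w | admissible_prim w]].

(* For [U] in [G h] the primitive state is unique, by the bounds on the partial
   derivatives of [h] in [eos]; outside [G h] the value is a dummy. *)
Definition recover (R : realType) (h : R -> R -> R) (U : state R) : prim R :=
  xget (Prim 0 0 0 0) [set w | admissible_prim w /\ cons h w = U].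

Definition prim_flux (R : realType) (h : R -> R -> R) (l : 'I_3) (w : prim R) :
    state R :=
  mk_state (density w * vel w 0 l)
    (vel w 0 l *: momentum h w
       - mag w 0 l *: (lorentz w ^- 2 *: mag w + dot (vel w) (mag w) *: vel w)
       + p_tot w *: delta_mx 0 l)
    (vel w 0 l *: mag w - mag w 0 l *: vel w)
    (momentum h w 0 l).

Definition flux (R : realType) (h : R -> R -> R) (l : 'I_3) (U : state R) :
    state R :=
  prim_flux h l (recover h U).

(* [inord] embeds ['I_d] into ['I_3]; this is faithful because [d <= 3]. *)
Definition dir_flux (R : realType) (h : R -> R -> R) (d : nat)
    (xi : 'rV[R]_d) (U : state R) : state R :=
  \sum_(l < d) xi 0 l *: flux h (inord l) U.

Definition num_flux (R : realType) (h : R -> R -> R) (alpha : R) (d : nat)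
    (xi : 'rV[R]_d) (U V : state R) : state R :=
  2^-1 *: (dir_flux h xi U + dir_flux h xi V - alpha *: (V - U)).

Definition diam (R : realType) (d : nat) (A : set 'rV[R]_d) : \bar R :=
  Order.max 0%E
    (ereal_sup [set z : \bar R | exists x y,
                  [/\ A x, A y & z = (enorm (x - y))%:E]]).

(* Volume of the unit ball of R^n, from omega_n = (2 pi / n) omega_(n-2). *)
Fixpoint ball_volume (R : realType) (n : nat) : R :=
  match n with
  | 0 => 1
  | 1 => 2
  | n'.+2 => 2 * pi / n%:R * ball_volume R n'
  end.

Definition hausdorff_pre (R : realType) (d n : nat) (delta : R)
    (A : set 'rV[R]_d) : \bar R :=
  ereal_inf [set z : \bar R | exists C : nat -> set 'rV[R]_d,
    [/\ A `<=` \bigcup_i C i,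
        (forall i, (diam (C i) <= delta%:E)%E) &
        z = (\sum_(0 <= i <oo)
               (ball_volume R n / 2 ^+ n)%:E * diam (C i) ^+ n)%E]].

(* [n]-dimensional Hausdorff measure for [n > 0], normalised so as to agree with
   Lebesgue measure when [n = d]; the supremum is the limit as [delta] tends
   to 0. *)
Definition hausdorff (R : realType) (d n : nat) (A : set 'rV[R]_d) : \bar R :=
  ereal_sup [set hausdorff_pre n delta A | delta in [set delta : R | 0 < delta]].

Definition boundary (T : topologicalType) (A : set T) : set T :=
  closure A `\` interior A.

(* [V] is a nondegenerate [d]-simplex when its edge vectors at [V ord0] are
   linearly independent. *)
Definition nondegenerate (R : realType) (d : nat) (V : 'I_d.+1 -> 'rV[R]_d) :
    Prop :=
  row_free (\matrix_(i < d) (V (lift ord0 i) - V ord0)).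

Definition simplex (R : realType) (d : nat) (V : 'I_d.+1 -> 'rV[R]_d) :
    set 'rV[R]_d :=
  [set x | exists c : 'I_d.+1 -> R,
     [/\ forall i, 0 <= c i, \sum_i c i = 1 & x = \sum_i c i *: V i]].

(* [A] is a topological manifold of dimension [n]: near each of its points it
   is homeomorphic, by [f] with inverse [g], to an open subset [O] of R^n. *)
Definition embedded_manifold (R : realType) (d n : nat) (A : set 'rV[R]_d) :
    Prop :=
  forall x, A x ->
    exists (N : set 'rV[R]_d) (O : set 'rV[R]_n)
           (f : 'rV[R]_d -> 'rV[R]_n) (g : 'rV[R]_n -> 'rV[R]_d),
      [/\ open N /\ N x, open O, f @` (A `&` N) = O,
          forall y, (A `&` N) y -> g (f y) = y &
          {within A `&` N, continuous f} /\ {within O, continuous g}].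

(* A possibly nonconvex [d]-polytope; it is non-self-intersecting in that its
   boundary is an embedded hypersurface, which does not touch itself. *)
Definition polytope (R : realType) (d : nat) (A : set 'rV[R]_d) : Prop :=
  [/\ exists (s : nat) (V : 'I_s -> 'I_d.+1 -> 'rV[R]_d),
        (forall i, nondegenerate (V i)) /\
        A = \bigcup_(i in [set: 'I_s]) simplex (V i),
      A !=set0,
      connected (interior A) &
      embedded_manifold d.-1 (boundary A)].

Definition face (R : realType) (d : nat) (K : choiceType)
    (cell : K -> set 'rV[R]_d) (k j : K) : set 'rV[R]_d :=
  boundary (cell k) `&` boundary (cell j).

Definition neighbors (R : realType) (d : nat) (K : choiceType)
    (cell : K -> set 'rV[R]_d) (k : K) : set K :=
  [set j | j <> k /\ (0 < hausdorff d.-1 (face cell k j))%E].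

(* [F] lies in a hyperplane with unit normal [xi], and at each point of the
   interior of [F] relative to that hyperplane [xi] points from [A] to [A']. *)
Definition unit_normal (R : realType) (d : nat) (F A A' : set 'rV[R]_d)
    (xi : 'rV[R]_d) : Prop :=
  [/\ enorm xi = 1,
      (forall x y, F x -> F y -> dot xi (y - x) = 0) &
      (forall x, F x ->
         (exists r : R, 0 < r /\
            forall y, dot xi (y - x) = 0 -> enorm (y - x) < r -> F y) ->
         exists e : R, 0 < e /\
           forall t : R, 0 < t -> t < e ->
             interior A (x - t *: xi) /\ interior A' (x + t *: xi))].

Record mesh (R : realType) (d : nat) (K : choiceType) : Type := Mesh {
  cell : K -> set 'rV[R]_d;
  normal : K -> K -> 'rV[R]_d;
  cell_polytope : forall k, polytope (cell k);
  cell_disjoint : forall k j, k <> j ->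
    interior (cell k) `&` interior (cell j) = set0;
  neighbors_finite : forall k, finite_set (neighbors cell k);
  normalP : forall k j, neighbors cell k j ->
    unit_normal (face cell k j) (cell k) (cell j) (normal k j) }.

(* The cells to which the scheme applies.  If the domain has a boundary, the
   outermost members of [K] are ghost cells carrying the boundary data, and the
   faces of a ghost cell need not all be shared; the index type may also be
   infinite, and then every cell can be interior. *)
Definition interior_cell (R : realType) (d : nat) (K : choiceType)
    (M : mesh R d K) (k : K) : Prop :=
  boundary (cell M k) = \bigcup_(j in neighbors (cell M) k) face (cell M) k j.

Definition cell_volume (R : realType) (d : nat) (K : choiceType)
    (M : mesh R d K) (k : K) : R :=
  fine (hausdorff d (cell M k)).

Definition face_area (R : realType) (d : nat) (K : choiceType)
    (M : mesh R d K) (k j : K) : R :=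
  fine (hausdorff d.-1 (face (cell M) k j)).

Definition scheme_update (R : realType) (h : R -> R -> R) (d : nat)
    (K : choiceType) (M : mesh R d K) (alpha dt : R) (U : K -> state R) (k : K) :
    state R :=
  U k - (dt / cell_volume M k) *:
    \sum_(j \in neighbors (cell M) k)
      face_area M k j *: num_flux h alpha (normal M k j) (U k) (U j).

Definition CFL (R : realType) (d : nat) (K : choiceType) (M : mesh R d K)
    (alpha dt : R) (k : K) : Prop :=
  0 < alpha * dt / (2 * cell_volume M k) *
        \sum_(j \in neighbors (cell M) k) face_area M k j < 1.

(* Main.v *)
(* States at rest with small pressure and density already break the scheme, the
   obstruction being a nonzero discrete divergence of the magnetic field.  Fix a
   neighbour i of k across a face of nonzero area, with normal n, and give every
   cell the field n, except cell i, which gets b n.  After one step the field of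
   cell k is (1 + lam (b - 1)) n.  An admissible state whose magnetic field B is
   parallel to the unit vector n satisfies |m . n| <= E - |B|^2 / 2, since the
   magnetic part of its momentum is orthogonal to n.  As p and rho tend to 0, the
   updated right-hand side tends to lam (1 - lam) (b - 1)^2 / 2, whereas m . n
   tends to A + c (b^2 - 1) with c <> 0.  If A <> 0, take b = 1; otherwise the
   momentum is of first order in b - 1 and the energy surplus of second order, so
   any b > 1 close to 1 violates the bound.  Treating A as a free constant makes
   the geometric identity sum_j |E_kj| xi_kj = 0 superfluous. *)
From HB Require Import structures.
Require Import Defs.
From mathcomp Require Import all_boot all_order all_algebra.
From mathcomp Require Import all_classical all_reals all_analysis.
From mathcomp Require Import ring lra.
Import Order.TTheory GRing.Theory Num.Theory.
Import numFieldNormedType.Exports.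

Local Open Scope ring_scope.

(** * Euclidean inner product *)

Lemma dotC (R : realType) (n : nat) (x y : 'rV[R]_n) : dot x y = dot y x.
Proof. by apply: eq_bigr => i _; rewrite mulrC. Qed.

Lemma dot_is_linear (R : realType) (n : nat) (y : 'rV[R]_n) :
  linear ((@dot R n)^~ y : 'rV[R]_n -> R^o).
Proof.
move=> a u v; rewrite /dot scaler_sumr -big_split; apply: eq_bigr => i _ /=.
by rewrite !mxE mulrDl -mulrA.
Qed.

(** The fixed vector comes first and the codomain is [R^o], so that pairing with [y] is an instance
    of a linear map. *)
Definition dotr (R : realType) (n : nat) (y : 'rV[R]_n) (x : 'rV[R]_n) : R^o :=
  dot x y.

HB.instance Definition _ (R : realType) (n : nat) (y : 'rV[R]_n) :=
  GRing.isLinear.Build R 'rV[R]_n R^o *:%R (dotr R n y) (dot_is_linear R n y).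

Lemma dotDl (R : realType) (n : nat) (x y z : 'rV[R]_n) :
  dot (x + y) z = dot x z + dot y z.
Proof. exact: (linearD (dotr R n z)). Qed.

Lemma dotBl (R : realType) (n : nat) (x y z : 'rV[R]_n) :
  dot (x - y) z = dot x z - dot y z.
Proof. exact: (linearB (dotr R n z)). Qed.

Lemma dotZl (R : realType) (n : nat) (a : R) (x z : 'rV[R]_n) :
  dot (a *: x) z = a * dot x z.
Proof. exact: (linearZ_LR (dotr R n z)). Qed.

Lemma dot0l (R : realType) (n : nat) (z : 'rV[R]_n) : dot 0 z = 0.
Proof. exact: (linear0 (dotr R n z)). Qed.

Lemma dot_suml (R : realType) (n : nat) (I : Type) (s : seq I)
    (F : I -> 'rV[R]_n) (z : 'rV[R]_n) :
  dot (\sum_(i <- s) F i) z = \sum_(i <- s) dot (F i) z.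
Proof. exact: (linear_sum (dotr R n z)). Qed.

Lemma dotZr (R : realType) (n : nat) (a : R) (x z : 'rV[R]_n) :
  dot x (a *: z) = a * dot x z.
Proof. by rewrite dotC dotZl dotC. Qed.

Lemma dot_deltal (R : realType) (n : nat) (i : 'I_n) (z : 'rV[R]_n) :
  dot (delta_mx 0 i) z = z 0 i.
Proof.
rewrite /dot (bigD1 i) //= mxE !eqxx mul1r big1 ?addr0 // => j ji.
by rewrite mxE (negbTE ji) andbF mul0r.
Qed.

Lemma dot_ge0 (R : realType) (n : nat) (x : 'rV[R]_n) : 0 <= dot x x.
Proof. by apply: sumr_ge0 => i _; rewrite -expr2 sqr_ge0. Qed.

Lemma dot_eq0 (R : realType) (n : nat) (x : 'rV[R]_n) : dot x x = 0 -> x = 0.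
Proof.
move=> /eqP; rewrite psumr_eq0 => [/allP x0|i _]; last by rewrite -expr2 sqr_ge0.
apply/rowP => i; rewrite mxE.
by have := x0 i (mem_index_enum i); rewrite mulf_eq0 orbb => /eqP.
Qed.

Lemma enorm_sqr (R : realType) (n : nat) (x : 'rV[R]_n) : enorm x ^+ 2 = dot x x.
Proof. exact/sqr_sqrtr/dot_ge0. Qed.

Lemma dot_sqr_le (R : realType) (n : nat) (x y : 'rV[R]_n) :
  dot x y ^+ 2 <= dot x x * dot y y.
Proof.
have [/dot_eq0 ->|y0] := eqVneq (dot y y) 0.
  by rewrite (dotC _ _ x) !dot0l expr0n mulr0.
have ygt0 : 0 < dot y y by rewrite lt0r y0 dot_ge0.
have := dot_ge0 R n (dot y y *: x - dot x y *: y).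
rewrite dotBl !dotZl ![dot _ (_ - _)]dotC !dotBl !dotZl (dotC _ _ y x).
have -> : dot y y * (dot y y * dot x x - dot x y * dot x y) -
  dot x y * (dot y y * dot x y - dot x y * dot y y)
  = dot y y * (dot x x * dot y y - dot x y ^+ 2) by ring.
by rewrite pmulr_rge0 // subr_ge0.
Qed.

(** * Momentum, magnetic field and energy as linear maps, which commute with the scheme *)

Definition momentum_part (R : realType) : {linear state R -> 'rV[R]_3} :=
  rsubmx \o lsubmx \o lsubmx.

Definition magnetic_part (R : realType) : {linear state R -> 'rV[R]_3} :=
  rsubmx \o lsubmx.

Definition energy_part (R : realType) : {linear state R -> 'rV[R]_1} := rsubmx.

Lemma momentum_partE (R : realType) (D : R) (m b : 'rV[R]_3) (E : R) :
  momentum_part R (mk_state D m b E) = m.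
Proof. by rewrite /= !(row_mxKl, row_mxKr). Qed.

Lemma magnetic_partE (R : realType) (D : R) (m b : 'rV[R]_3) (E : R) :
  magnetic_part R (mk_state D m b E) = b.
Proof. by rewrite /= !(row_mxKl, row_mxKr). Qed.

Lemma energy_partE (R : realType) (D : R) (m b : 'rV[R]_3) (E : R) :
  energy_part R (mk_state D m b E) = E%:M.
Proof. by rewrite /= !(row_mxKl, row_mxKr). Qed.

Lemma parts_cons (R : realType) (h : R -> R -> R) (w : prim R) :
  [/\ momentum_part R (cons h w) = momentum h w,
      magnetic_part R (cons h w) = mag w &
      energy_part R (cons h w) = (energy h w)%:M].
Proof. by split; rewrite ?momentum_partE ?magnetic_partE ?energy_partE. Qed.

Lemma mk_state_inj (R : realType) (D D' : R) (m m' b b' : 'rV[R]_3) (E E' : R) :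
  mk_state D m b E = mk_state D' m' b' E' -> [/\ D = D', m = m', b = b' & E = E'].
Proof.
have scalI (x y : R) : x%:M = y%:M :> 'rV[R]_1 -> x = y.
  by move=> /rowP/(_ 0); rewrite !mxE.
by move=> /eq_row_mx[/eq_row_mx[/eq_row_mx[/scalI-> ->] ->] /scalI->].
Qed.

(** * Bounds on admissible states *)

(** Both summands of the lower bound on [h] in [eos] are at least [p / r]. Hence the thermal energy
    [r * h p r - p] dominates [p]. *)
Lemma eos_ge (R : realType) (h : R -> R -> R) (p r : R) :
  eos h -> 0 < p -> 0 < r -> 2 * p <= r * h p r.
Proof.
move=> [_ hge _ _] p0 r0; have := hge _ _ p0 r0.
have pr0 : 0 < p / r by rewrite divr_gt0.
have : p / r <= Num.sqrt (1 + p ^+ 2 / r ^+ 2).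
  rewrite -expr_div_n -[leLHS](gtr0_norm pr0) -sqrtr_sqr.
  by apply: ler_wsqrtr; rewrite lerDr ler01.
move=> s1 s2; have : 2 * (p / r) <= h p r by lra.
by rewrite mulrA ler_pdivrMr // [h _ _ * _]mulrC.
Qed.

Lemma lorentz_sqr (R : realType) (w : prim R) : enorm (vel w) < 1 ->
  lorentz w ^- 2 = 1 - dot (vel w) (vel w) /\ 0 < 1 - dot (vel w) (vel w).
Proof.
move=> v1; have v2 : 0 < 1 - dot (vel w) (vel w).
  by rewrite -enorm_sqr subr_gt0 expr_lt1 // sqrtr_ge0.
by split=> //; rewrite /lorentz -exprVn invrK enorm_sqr sqr_sqrtr // ltW.
Qed.

(** With X = rho h W^2 and c = v . n, the momentum along n is X c, and the right-hand side is X - p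
    + b^2 (|v|^2 - c^2) / 2. The magnetic term is nonnegative by Cauchy-Schwarz, so it remains to
    see X |c| <= X - p. *)
Lemma admissible_energy_bound (R : realType) (h : R -> R -> R) (w : prim R)
    (n : 'rV[R]_3) (b : R) :
  eos h -> admissible_prim w -> dot n n = 1 -> mag w = b *: n ->
  `|dot (momentum h w) n| <= energy h w - b ^+ 2 / 2.
Proof.
move=> eosh [r0 p0 v1] nn wB.
have [W v2] := lorentz_sqr R w v1.
rewrite /energy /p_tot /p_m /momentum /enthalpy W !enorm_sqr wB.
rewrite dotBl dotDl !dotZl !dotZr nn.
have hp := eos_ge R h _ _ eosh p0 r0.
have cs := dot_sqr_le R 3 (vel w) n; rewrite nn mulr1 in cs.
have W2 : lorentz w ^+ 2 = (1 - dot (vel w) (vel w))^-1 by rewrite -W invrK.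
rewrite W2.
set rh := rho w * _ in hp *; set v := dot (vel w) (vel w) in cs v2 *.
set c := dot (vel w) n in cs *; set p := pres w in hp p0 *.
set W' := _^-1.
have W'E : W' * (1 - v) = 1 by rewrite mulVf ?gt_eqF.
have W'0 : 0 < W' by rewrite invr_gt0.
set X := rh * W'.
have X0 : 0 < X by rewrite mulr_gt0 //; lra.
have c1 : `|c| * `|c| <= v by rewrite -expr2 real_normK ?num_real.
have cge := normr_ge0 c.
have -> : X * c + b * (b * 1) * c - b * c * (b * 1) = X * c by ring.
rewrite normrM gtr0_norm //.
have [s [s0 sv]] : exists s, 0 <= s /\ v = s * s.
  by exists (Num.sqrt v); rewrite sqrtr_ge0 -expr2 sqr_sqrtr // dot_ge0.
have cs1 : `|c| <= s by rewrite -(@ler_pXn2r _ 2) // !expr2 -sv.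
have s1 : s < 1.
  rewrite ltNge; apply/negP => s1.
  have : 1 * 1 <= s * s by apply: ler_pM.
  lra.
have Xs : X * (1 - s) * (1 + s) = rh.
  transitivity (rh * (W' * (1 - v))); last by rewrite W'E mulr1.
  by rewrite sv /X; ring.
(* Here s = |v|, and 1 + s <= 2 uses up the factor 2 of [eos_ge]. *)
have Xp : p <= X * (1 - s).
  have : X * (1 - s) * (1 + s) <= X * (1 - s) * 2.
    by apply: ler_wpM2l; [apply: mulr_ge0|]; lra.
  lra.
have Xc : X * `|c| <= X * s by apply: ler_wpM2l => //; lra.
have : 0 <= b ^+ 2 * (v - c ^+ 2) by rewrite mulr_ge0 ?sqr_ge0 ?subr_ge0.
have -> : p + 2^-1 * ((1 - v) * (b * (b * 1)) + (b * c) ^+ 2) =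
  p + b ^+ 2 / 2 - b ^+ 2 * (v - c ^+ 2) / 2 by field.
have -> : b * (b * 1) = b ^+ 2 by ring.
lra.
Qed.

(** * States at rest and their fluxes *)

Lemma lorentz_static (R : realType) (w : prim R) : vel w = 0 -> lorentz w = 1.
Proof. by move=> v0; rewrite /lorentz enorm_sqr v0 dot0l subr0 sqrtr1 invr1. Qed.

Lemma momentum_static (R : realType) (h : R -> R -> R) (w : prim R) :
  vel w = 0 -> momentum h w = 0.
Proof. by move=> v0; rewrite /momentum v0 dot0l !scaler0 scale0r addr0 subr0. Qed.

Lemma p_m_static (R : realType) (w : prim R) :
  vel w = 0 -> p_m w = dot (mag w) (mag w) / 2.
Proof.
move=> v0; rewrite /p_m lorentz_static // v0 dot0l enorm_sqr.
by rewrite expr1n invr1 mul1r expr0n addr0 mulrC.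
Qed.

Lemma energy_static (R : realType) (h : R -> R -> R) (w : prim R) : vel w = 0 ->
  energy h w = rho w * enthalpy h w - pres w + dot (mag w) (mag w) / 2.
Proof.
move=> v0; rewrite /energy lorentz_static // /p_tot p_m_static // enorm_sqr.
by field.
Qed.

(** Pairing with v gives m . v = X |v|^2 + (|B|^2 |v|^2 - (v . B)^2), where X > 0 and the bracket is
    nonnegative by Cauchy-Schwarz. *)
Lemma momentum_eq0 (R : realType) (h : R -> R -> R) (w : prim R) :
  eos h -> admissible_prim w -> momentum h w = 0 -> vel w = 0.
Proof.
move=> eosh [r0 p0 v1] m0; have [W v2] := lorentz_sqr R w v1.
have W20 : 0 < lorentz w ^+ 2 by rewrite -invr_gt0 W.
have hp := eos_ge R h _ _ eosh p0 r0.
have X0 : 0 < rho w * enthalpy h w * lorentz w ^+ 2.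
  by rewrite mulr_gt0 // /enthalpy; lra.
have : dot (momentum h w) (vel w) = 0 by rewrite m0 dot0l.
rewrite /momentum dotBl dotDl !dotZl enorm_sqr (dotC _ _ (mag w)).
have := dot_sqr_le R 3 (vel w) (mag w); have := dot_ge0 R 3 (vel w).
set X := rho w * _ * _ in X0 *; rewrite expr2.
set v := dot (vel w) (vel w) => v0 cs E.
apply: dot_eq0; apply/eqP; rewrite eq_le v0 andbT.
rewrite -(pmulr_rle0 _ X0) -/v.
lra.
Qed.

(* Only the bound on the recovered pressure is needed, not its uniqueness. *)
Lemma recover_static (R : realType) (h : R -> R -> R) (r p : R) (B : 'rV[R]_3) :
  eos h -> 0 < r -> 0 < p ->
  exists2 p' : R, 0 < p' <= r * h p r - p &
    recover h (cons h (Prim r p 0 B)) = Prim r p' 0 B.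
Proof.
move=> eosh r0 p0; set w := Prim r p 0 B.
have wadm : admissible_prim w.
  by split=> //=; rewrite /enorm dot0l sqrtr0 ltr01.
(* Since [w] is a preimage, [xget] returns a genuine preimage rather than its dummy. *)
have := @xgetPex _ (Prim 0 0 0 0)
  [set w' | admissible_prim w' /\ cons h w' = cons h w]%classic
  (ex_intro _ w (conj wadm erefl)).
rewrite -/(recover h (cons h w)); case: (recover h _) => r' p' v' B' [w'adm].
move=> /mk_state_inj[]; rewrite (@momentum_static _ h w) // => D m0 /= BB.
have /= v'0 := momentum_eq0 _ _ _ eosh w'adm m0.
move: D; rewrite /density !lorentz_static //= !mulr1 => rr.
rewrite !energy_static //= /enthalpy /= BB rr => /addIr e.
have [/= r'0 p'0 _] := w'adm.
exists p'; last by rewrite v'0.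
(* Equal energies give equal thermal energies at p and p'; by [eos_ge] this common value dominates
   p'. *)
rewrite p'0 /= -e; have := eos_ge R h _ _ eosh p'0 r0; lra.
Qed.

Lemma prim_flux_static (R : realType) (h : R -> R -> R) (l : 'I_3) (w : prim R) :
  vel w = 0 ->
  prim_flux h l w =
    mk_state 0 ((pres w + dot (mag w) (mag w) / 2) *: delta_mx 0 l
                - mag w 0 l *: mag w) 0 0.
Proof.
move=> v0; rewrite /prim_flux momentum_static // lorentz_static //.
rewrite /p_tot p_m_static //.
rewrite v0 !mxE expr1n invr1 mulr0 dot0l !scale0r !scaler0 scale1r addr0 subr0.
by rewrite sub0r addrC.
Qed.

(** Zero extension to R^3 through the same [inord] as in [dir_flux]; an isometry for d <= 3. *)
Definition embed (R : realType) (d : nat) (xi : 'rV[R]_d) : 'rV[R]_3 :=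
  \sum_(l < d) xi 0 l *: delta_mx 0 (inord l).

Lemma dot_embed (R : realType) (d : nat) (xi : 'rV[R]_d) (z : 'rV[R]_3) :
  dot (embed R d xi) z = \sum_(l < d) xi 0 l * z 0 (inord l).
Proof. by rewrite dot_suml; apply: eq_bigr => l _; rewrite dotZl dot_deltal. Qed.

Lemma dot_embed_embed (R : realType) (d : nat) (xi : 'rV[R]_d) :
  (d <= 3)%N -> dot (embed R d xi) (embed R d xi) = dot xi xi.
Proof.
move=> d3; rewrite dot_embed; apply: eq_bigr => l _; congr (_ * _).
rewrite summxE (bigD1 l) //= big1 => [|m ml].
  by rewrite !mxE !eqxx mulr1 addr0.
rewrite !mxE eqxx /= -val_eqE /= !inordK ?(leq_trans (ltn_ord _)) //.
by rewrite eq_sym (negbTE (ml : val m != val l)) mulr0.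
Qed.

(** Magnetic tension subtracts b^2 along n and turns the magnetic pressure b^2 / 2 into - b^2 / 2.
    The recovered pressure is chosen before [xi], so one value serves all faces. *)
Lemma dir_flux_static (R : realType) (h : R -> R -> R) (r p b : R) (n : 'rV[R]_3) :
  eos h -> 0 < r -> 0 < p -> dot n n = 1 ->
  exists2 p' : R, 0 < p' <= r * h p r - p &
    forall (d : nat) (xi : 'rV[R]_d),
      let F := dir_flux h xi (cons h (Prim r p 0 (b *: n))) in
      [/\ dot (momentum_part R F) n = (p' - b ^+ 2 / 2) * dot (embed R d xi) n,
          magnetic_part R F = 0 & energy_part R F = 0].
Proof.
move=> eosh r0 p0 nn.
have [p' p'e rec] := recover_static R h r p (b *: n) eosh r0 p0.
exists p' => // d xi; rewrite /dir_flux /flux rec.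
under eq_bigr do rewrite prim_flux_static // dotZl dotZr nn.
rewrite !linear_sum; split.
- rewrite dot_suml dot_embed mulr_sumr; apply: eq_bigr => l _.
  rewrite linearZ_LR momentum_partE dotZl dotBl !dotZl dot_deltal nn mxE /=.
  by field.
- by rewrite big1 // => l _; rewrite linearZ_LR magnetic_partE scaler0.
- by rewrite big1 // => l _; rewrite linearZ_LR energy_partE raddf0 scaler0.
Qed.

Lemma static_state (R : realType) (h : R -> R -> R) (r p b : R) (n : 'rV[R]_3) :
  eos h -> 0 < r -> 0 < p -> dot n n = 1 ->
  exists (V : state R) (p' : R),
    [/\ G h V /\ 0 < p' <= r * h p r - p,
        momentum_part R V = 0,
        magnetic_part R V = b *: n,
        energy_part R V = (r * h p r - p + b ^+ 2 / 2)%:M &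
        forall (d : nat) (xi : 'rV[R]_d),
          [/\ dot (momentum_part R (dir_flux h xi V)) n =
                (p' - b ^+ 2 / 2) * dot (embed R d xi) n,
              magnetic_part R (dir_flux h xi V) = 0 &
              energy_part R (dir_flux h xi V) = 0]].
Proof.
move=> eosh r0 p0 nn.
have [p' p'e F] := dir_flux_static R h r p b n eosh r0 p0 nn.
exists (cons h (Prim r p 0 (b *: n))), p'; split => //.
- split=> //; exists (Prim r p 0 (b *: n)) => //; split=> //=.
  by rewrite /enorm dot0l sqrtr0 ltr01.
- by rewrite momentum_partE momentum_static.
- by rewrite magnetic_partE.
- by rewrite energy_partE energy_static //= dotZl dotZr nn mulr1 -expr2.
Qed.

(** * The scheme when a single neighbour differs *)

(** On faces other than the one shared with [i] both states are [V], so the dissipation vanishes and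
    the numerical flux is the exact one. *)
Lemma scheme_update_perturb (R : realType) (h : R -> R -> R) (d : nat)
    (K : choiceType) (M : mesh R d K) (alpha dt : R) (k i : K) (V V' : state R) :
  neighbors (cell M) k i ->
  scheme_update h M alpha dt (fun j => if j == i then V' else V) k =
  V - (dt / cell_volume M k) *:
    (\sum_(j \in neighbors (cell M) k)
       face_area M k j *: dir_flux h (normal M k j) V +
     (face_area M k i / 2) *:
       (dir_flux h (normal M k i) V' - dir_flux h (normal M k i) V
        - alpha *: (V' - V))).
Proof.
move=> ki; have Nfin := neighbors_finite M k.
have ik : (k == i) = false by case: ki => /nesym/eqP/negbTE.
rewrite /scheme_update ik; congr (_ - _ *: _).
have iN : i \in finmap.enum_fset (fset_set (neighbors (cell M) k)).
  by rewrite in_fset_set // inE.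
rewrite !fsbig_finite // !(bigD1_seq i) ?finmap.fset_uniq //= eqxx.
rewrite addrAC; congr (_ + _).
  rewrite /num_flux -scalerA -scalerDr; congr (_ *: _).
  by apply/rowP => c; rewrite !mxE; field.
apply: eq_bigr => j /negbTE ->; congr (_ *: _).
by rewrite /num_flux; apply/rowP => c; rewrite !mxE; field.
Qed.

Lemma linear_scheme_update (R : realType) (h : R -> R -> R) (d : nat)
    (K : choiceType) (M : mesh R d K) (alpha dt : R) (k i : K) (V V' : state R)
    (W : lmodType R) (f : {linear state R -> W}) :
  neighbors (cell M) k i ->
  f (scheme_update h M alpha dt (fun j => if j == i then V' else V) k) =
  f V - (dt / cell_volume M k) *:
    (\sum_(j \in neighbors (cell M) k)
       face_area M k j *: f (dir_flux h (normal M k j) V) +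
     (face_area M k i / 2) *:
       (f (dir_flux h (normal M k i) V') - f (dir_flux h (normal M k i) V)
        - alpha *: (f V' - f V))).
Proof.
move=> ki; have Nfin := neighbors_finite M k.
rewrite scheme_update_perturb // !fsbig_finite //.
rewrite (linearB f) (linearZ_LR f) (linearD f) (linear_sum f) (linearZ_LR f).
rewrite !(linearB f) (linearZ_LR f) (linearB f).
by congr (_ - _ *: (_ + _)); apply: eq_bigr => j _; rewrite (linearZ_LR f).
Qed.

Lemma dot_momentum_scheme_update (R : realType) (h : R -> R -> R) (d : nat)
    (K : choiceType) (M : mesh R d K) (alpha dt : R) (k i : K) (V V' : state R)
    (n : 'rV[R]_3) :
  neighbors (cell M) k i ->
  let m U := dot (momentum_part R U) n in
  m (scheme_update h M alpha dt (fun j => if j == i then V' else V) k) =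
  m V - (dt / cell_volume M k) *
    (\sum_(j \in neighbors (cell M) k)
       face_area M k j * m (dir_flux h (normal M k j) V) +
     (face_area M k i / 2) *
       (m (dir_flux h (normal M k i) V') - m (dir_flux h (normal M k i) V)
        - alpha * (m V' - m V))).
Proof.
move=> ki; pose f : {linear state R -> R^o} := dotr R 3 n \o momentum_part R.
exact: (linear_scheme_update R h d K M alpha dt k i V V' R^o f ki).
Qed.

Lemma exists_dominating (R : realType) (A c L : R) : c != 0 ->
  exists b : R, L * (b - 1) ^+ 2 < `|A + c * (b ^+ 2 - 1)|.
Proof.
move=> c0; have [->|A0] := eqVneq A 0; last first.
  by exists 1; rewrite subrr expr0n mulr0 expr1n subrr mulr0 addr0 normr_gt0.
have c1 : 0 < `|c| by rewrite normr_gt0.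
have L1 : 0 < `|L| + 1 by rewrite ltr_wpDl.
(* This x gives L x <= |c| < |c| (2 + x). *)
pose x := `|c| / (`|L| + 1); have x0 : 0 < x by rewrite divr_gt0.
exists (1 + x); rewrite add0r.
have -> : (1 + x) ^+ 2 - 1 = x * (2 + x) by ring.
have -> : L * (1 + x - 1) ^+ 2 = x * (L * x) by ring.
rewrite (mulrCA c) normrM gtr0_norm // ltr_pM2l // normrM.
rewrite (gtr0_norm (_ : 0 < 2 + x)); last by lra.
have Lx : L * x <= `|L| * x by rewrite ler_wpM2r ?ler_norm // ltW.
have : (`|L| + 1) * x = `|c| by rewrite mulrC divfK // gt_eqF.
have : 0 < `|c| * x by rewrite mulr_gt0.
lra.
Qed.

(** * Violation of the energy bound after one step *)

Theorem theorem3p1 (R : realType) (h : R -> R -> R) (h_eos : eos h)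
    (d : nat) (d_23 : d = 2%N \/ d = 3%N)
    (K : choiceType) (M : mesh R d K)
    (alpha : R) (alpha_ge1 : 1 <= alpha) (dt : R) (dt_gt0 : 0 < dt)
    (k : K) (k_interior : interior_cell M k) (k_CFL : CFL M alpha dt k) :
  exists U : K -> state R,
    (forall j, G h (U j)) /\ ~ G h (scheme_update h M alpha dt U k).
Proof.
have /andP[CFL_gt0 _] := k_CFL.
(* A neighbour has positive Hausdorff measure, but [fine] would send an infinite one to 0; a nonzero
   area comes from the positive CFL number. *)
have [i ki a0] : exists2 i, neighbors (cell M) k i & face_area M k i != 0.
  apply: contrapT => H; move: CFL_gt0; rewrite fsbig1 ?mulr0 ?ltxx // => j kj.
  by apply/eqP; apply: contrapT => /negP aj; apply: H; exists j.
have vol0 : cell_volume M k != 0.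
  by apply/eqP => v0; move: CFL_gt0; rewrite v0 mulr0 invr0 mulr0 mul0r ltxx.
pose n := embed R d (normal M k i).
have nn : dot n n = 1.
  rewrite dot_embed_embed; last by case: d_23 => ->.
  by have [xi1 _ _] := Defs.normalP ki; rewrite -enorm_sqr xi1 expr1n.
pose tau := dt / cell_volume M k.
pose T := \sum_(j \in neighbors (cell M) k)
  face_area M k j * dot (embed R d (normal M k j)) n.
(* In the limit of zero pressure the updated m . n is A + c (b^2 - 1); [lam] is the weight of cell
   [i] in the updated magnetic field and energy. *)
pose A := tau * T / 2; pose c := tau * face_area M k i / 4.
pose lam := alpha * tau * face_area M k i / 2.
have c0 : c != 0.
  rewrite /c /tau !(mulf_eq0, invr_eq0) (gt_eqF dt_gt0) (negbTE vol0) (negbTE a0).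
  by rewrite pnatr_eq0.
have [b gap] := exists_dominating R A c (lam * (1 - lam) / 2) c0.
(* The thermal terms perturb the limiting inequality by at most e X: e from the energy, 2 |A| e and
   2 |c| e from the recovered pressures, which lie in (0, e]. The density [r] makes 2 r X equal to
   the gap. *)
set g := `|_| in gap; pose X := 1 + 2 * `|A| + 2 * `|c|.
have X0 : 0 < X by rewrite /X; have := normr_ge0 A; have := normr_ge0 c; lra.
pose r := (g - lam * (1 - lam) / 2 * (b - 1) ^+ 2) / (2 * X).
have r0 : 0 < r by rewrite divr_gt0 ?subr_gt0 // mulr_gt0.
(* As h tends to 1, a small p gives h < 2, hence e < 2 r. *)
have [p p0 hp2] : exists2 p, 0 < p & h p r < 2.
  have [_ _ _ /(_ r r0) hlim] := h_eos.
  have lt12 : (1 : R) < 2 by lra.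
  near (0 : R)^'+%classic => p; exists p; first by near: p; exact: nbhs_right_gt.
  by near: p; exact: (cvgr_lt _ hlim _ lt12).
pose e := r * h p r - p.
have eX : e * X < g - lam * (1 - lam) / 2 * (b - 1) ^+ 2.
  have -> : g - lam * (1 - lam) / 2 * (b - 1) ^+ 2 = (2 * r) * X.
    by rewrite /r; field; rewrite gt_eqF.
  rewrite ltr_pM2r // /e; have : r * h p r < r * 2 by rewrite ltr_pM2l.
  lra.
have [V1 [p1 [[V1G p1e] mV1 BV1 EV1 F1]]] :=
  static_state R h r p 1 n h_eos r0 p0 nn.
have [V2 [p2 [[V2G p2e] mV2 BV2 EV2 F2]]] :=
  static_state R h r p b n h_eos r0 p0 nn.
rewrite -/e in p1e p2e EV1 EV2.
exists (fun j => if j == i then V2 else V1); split=> [j|]; first by case: ifP.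
move=> [w wadm wE].
have Nfin := neighbors_finite M k.
have [m1 B1 E1] := F1 _ (normal M k i); have [m2 B2 E2] := F2 _ (normal M k i).
have [mw Bw Ew] := parts_cons R h w.
have wmom : dot (momentum h w) n =
    A * (1 - 2 * p1) + c * (b ^+ 2 - 1) - 2 * c * (p2 - p1).
  rewrite -mw wE dot_momentum_scheme_update //.
  rewrite mV1 mV2 !dot0l m1 m2 -/n.
  rewrite nn (_ : \sum_(j \in _) _ = (p1 - 1 ^+ 2 / 2) * T); last first.
    rewrite /T !fsbig_finite // mulr_sumr; apply: eq_bigr => j _.
    by have [-> _ _] := F1 _ (normal M k j); rewrite mulrCA.
  by rewrite /A /c -/tau; field.
have wmag : mag w = (1 + lam * (b - 1)) *: n.
  rewrite -Bw wE linear_scheme_update // BV1 BV2 B1 B2 fsbig1; last first.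
    by move=> j _; have [_ -> _] := F1 _ (normal M k j); rewrite scaler0.
  by rewrite -/tau; apply/rowP => l; rewrite !mxE /lam; field.
have wen : energy h w = e + 1 / 2 + lam * (b ^+ 2 - 1) / 2.
  have /rowP/(_ 0) := Ew.
  rewrite wE linear_scheme_update // EV1 EV2 E1 E2 fsbig1; last first.
    by move=> j _; have [_ _ ->] := F1 _ (normal M k j); rewrite scaler0.
  by rewrite !mxE !eqxx !mulr1n => <-; rewrite /lam -/tau; field.
have := admissible_energy_bound R h w n _ h_eos wadm nn wmag.
rewrite wmom wen.
set P := (X in `|X| <= _).
have gP : g <= `|P| + 2 * `|A| * e + 2 * `|c| * e.
  have [/andP[p1_gt0 p1_le] /andP[p2_gt0 p2_le]] := (p1e, p2e).
  have -> : g = `|P + 2 * A * p1 + 2 * c * (p2 - p1)|.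
    by rewrite /g /P; congr `|_|; ring.
  apply: le_trans (ler_normD _ _) _; apply: lerD.
    apply: le_trans (ler_normD _ _) _; rewrite lerD2l !normrM normr_nat.
    by rewrite (gtr0_norm p1_gt0) ler_wpM2l // mulr_ge0.
  rewrite !normrM normr_nat ler_wpM2l ?mulr_ge0 //.
  by rewrite ler_norml; lra.
move: eX; rewrite /X mulrDr mulrDr.
(* Beyond e, the surplus is the convexity defect of B^2 / 2 at the values 1 and b with weights 1 -
   lam and lam. *)
have -> : e + 1 / 2 + lam * (b ^+ 2 - 1) / 2 - (1 + lam * (b - 1)) ^+ 2 / 2 =
  e + lam * (1 - lam) / 2 * (b - 1) ^+ 2 by field.
lra.
Unshelve. all: by end_near. Qed.
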